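(* There are universal constants $c,C>0$ such that for every partial Boolean function $h:\{0,1\}^n\to\{0,1,*\}$ there is a bounded multilinear real polynomial $q$ in $n$ variables of degree at most $C\,\mathrm{Q}(h)$ that approximately computes $h$ with robustness $\delta=c/\max(1,\mathrm{Q}(h))^2$.
   Context: For a partial Boolean function $h:\{0,1\}^n\to\{0,1,*\}$, $\mathrm{Dom}(h)=\{x:h(x)\ne*\}$. $\mathrm{Q}(h)$ is the bounded-error quantum query complexity of $h$: the minimum number of queries to the bits of $x$ made by a quantum algorithm that, for every $x\in\mathrm{Dom}(h)$, outputs $h(x)$ with probability at least $2/3$ (its behavior on inputs outside $\mathrm{Dom}(h)$ is arbitrary). A real polynomial $q$ in $n$ variables is bounded if $q(x)\in[0,1]$ for all $x\in\{0,1\}^n$. It approximately computes $h$ with robustness $\delta\in[0,1/2)$ if for every $x\in\mathrm{Dom}(h)$ and every $\Delta\in[-\delta,\delta]^n$, $|h(x)-q(x+\Delta)|\le1/3$. *)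

(* Defs.v *)
From mathcomp Require Import all_boot all_order all_algebra all_fingroup.
From mathcomp Require Import boolp reals complex mpoly.

Set Implicit Arguments.
Unset Strict Implicit.
Unset Printing Implicit Defensive.

Import Order.TTheory GRing.Theory Num.Theory.
Local Open Scope ring_scope.

Definition cube (n : nat) : finType := {ffun 'I_n -> bool}.

(* [h x = None] encodes h(x) = *, so Dom(h) = {x | h x <> None}. *)
Definition pbool (n : nat) : Type := cube n -> option bool.

(** * Quantum query algorithms *)

(* The basis state (i, b, w) consists of a query index, a query target bit and
   a workspace content.  The index None is the usual "no query" index (x_0 = 0
   in the literature); it also keeps the state space nonzero when n = 0. *)
Definition qbasis (n : nat) (W : finType) : finType :=
  (option 'I_n * bool * W)%type.

Definition ket (K : nzRingType) (S : finType) (s : S) : 'cV[K]_#|S| :=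
  delta_mx (enum_rank s) 0.

(* The matrix sending |t> to |f t>. *)
Definition basis_mx (K : nzRingType) (S : finType) (f : S -> S) : 'M[K]_#|S| :=
  \matrix_(s, t) (enum_val s == f (enum_val t))%:R.

Definition query (n : nat) (W : finType) (x : cube n) (s : qbasis n W) :
    qbasis n W :=
  let: (i, b, w) := s in (i, b (+) oapp x false i, w).

(* The unitaries do not depend on the input.  An algorithm making T queries only
   uses qunitary 0, ..., qunitary T. *)
Record qalgorithm (R : realType) (n : nat) := QAlgorithm {
  qwork : finType;
  qstart : qbasis n qwork;
  qunitary : nat -> 'M[R[i]]_#|qbasis n qwork|;
  qunitaryP : forall k, qunitary k \is unitarymx;
  qoutcome : qbasis n qwork -> bool
}.

(* U_T O_x U_(T-1) ... O_x U_0 |start> *)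
Fixpoint qstate (R : realType) (n : nat) (A : qalgorithm R n) (x : cube n)
    (T : nat) : 'cV[R[i]]_#|qbasis n (qwork A)| :=
  match T with
  | 0 => qunitary A 0 *m ket _ (qstart A)
  | T'.+1 =>
      qunitary A T'.+1 *m (basis_mx _ (query x) *m qstate A x T')
  end.

(* Probability of reading b when the final state is measured in the
   computational basis and the result s is mapped to qoutcome s. *)
Definition qprob (R : realType) (n : nat) (A : qalgorithm R n) (T : nat)
    (x : cube n) (b : bool) : R[i] :=
  \sum_(s : qbasis n (qwork A) | qoutcome s == b)
     `|qstate A x T (enum_rank s) 0| ^+ 2.

Definition qcomputes (R : realType) (n : nat) (h : pbool n) (T : nat) : Prop :=
  exists A : qalgorithm R n, forall (x : cube n) (b : bool),
    h x = Some b -> 2%:R / 3%:R <= qprob A T x b.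

Lemma mul_basis_mx_ket (K : nzRingType) (S : finType) (f : S -> S) (s : S) :
  basis_mx K f *m ket K s = ket K (f s).
Proof.
rewrite /ket -colE; apply/colP => i; rewrite !mxE eqxx andbT enum_rankK.
by rewrite -(inj_eq enum_val_inj) enum_rankK.
Qed.

Lemma basis_mx_unitary (R : realType) (S : finType) (f : S -> S) :
  injective f -> basis_mx R[i] f \is unitarymx.
Proof.
move=> fI; rewrite -trmxC_unitary; apply/unitarymxP; apply/matrixP => i j.
rewrite !mxE (bigD1 (enum_rank (f (enum_val j)))) //= !mxE enum_rankK eqxx.
rewrite big1 ?addr0 => [|k kj].
  by rewrite !rmorph_nat mulr1 (inj_eq fI) (inj_eq enum_val_inj) eq_sym.
rewrite !mxE !rmorph_nat.
suff /negPf-> : enum_val k != f (enum_val j) by rewrite mulr0.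
by apply: contra kj => /eqP <-; rewrite enum_valK.
Qed.

(* Querying all n bits one after the other computes any h exactly, so that the
   minimum defining Q(h) exists: after k queries the algorithm below is in the
   state |k, 0, x_0 ... x_(k-1) 0 ... 0>. *)
Definition store (n : nat) (k : nat) (s : qbasis n (cube n)) :
    qbasis n (cube n) :=
  let: (i, b, w) := s in
  let i' := tperm (insub k : option 'I_n) (insub k.+1) i in
  if (insub k : option 'I_n) is Some k'
  then (i', w k', [ffun j => if j == k' then b else w j]) else (i', b, w).

Lemma storeK (n k : nat) : involutive (@store n k).
Proof.
move=> [[i b] w]; rewrite /store; case: (insub k) => [k'|] /=; rewrite tpermK //.
congr (_, _, _); first by rewrite ffunE eqxx.
by apply/ffunP => j; rewrite !ffunE; case: eqP => [->|].
Qed.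

Lemma qcomputes_ex (R : realType) (n : nat) (h : pbool n) :
  exists T, `[< qcomputes R h T >].
Proof.
exists n; apply/asboolP.
pose U k := basis_mx R[i] (if k is k'.+1 then @store n k' else id).
have UP k : U k \is unitarymx.
  by apply: basis_mx_unitary; case: k => [|k] //; apply/inv_inj/storeK.
pose st (x : cube n) k : qbasis n (cube n) :=
  (insub k, false, [ffun i : 'I_n => (i < k)%N && x i]).
pose A := @QAlgorithm R n (cube n) (insub 0%N, false, [ffun=> false]) U UP
            (fun s => h s.2 == Some true).
exists A => x b hx.
have stE k : (k <= n)%N -> qstate A x k = ket _ (st x k).
  elim: k => [_|k IHk kn] /=; rewrite ?(IHk (ltnW kn)) !mul_basis_mx_ket.
    by congr (ket _ (_, _, _)); apply/ffunP => i; rewrite !ffunE.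
  congr ket; rewrite /st /store /query (insubT (fun i => i < n)%N kn) /=.
  rewrite tpermL; congr (_, _, _); first by rewrite ffunE ltnn.
  apply/ffunP => j; rewrite !ffunE -val_eqE /= ltnS [in RHS]leq_eqVlt.
  have [jk|_] //= := eqVneq (val j) k.
  by congr (fun_of_fin x _); apply/val_inj.
have xE : [ffun i : 'I_n => (i < n)%N && x i] = x.
  by apply/ffunP => i; rewrite ffunE ltn_ord.
rewrite /qprob stE // (bigD1 (st x n)) /=; last by rewrite xE hx; case: b {hx}.
rewrite mxE !eqxx normr1 expr1n -[X in X <= _]addr0 lerD //.
  by rewrite ler_pdivrMr ?ltr0n // mul1r ler_nat.
by apply: sumr_ge0 => s _; rewrite exprn_ge0.
Qed.

Definition Qquery (R : realType) (n : nat) (h : pbool n) : nat :=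
  ex_minn (qcomputes_ex R h).

(** * Polynomials *)

Definition cube_pt (R : realType) (n : nat) (x : cube n) : 'I_n -> R :=
  fun i => (x i)%:R.

Definition multilinear_mpoly (R : realType) (n : nat) (q : {mpoly R[n]}) : Prop :=
  forall m : 'X_{1..n}, m \in msupp q -> forall i, (m i <= 1)%N.

Definition mdegree (R : realType) (n : nat) (q : {mpoly R[n]}) : nat :=
  (msize q).-1.

Definition bounded_mpoly (R : realType) (n : nat) (q : {mpoly R[n]}) : Prop :=
  forall x : cube n, 0 <= q.@[cube_pt R x] <= 1.

Definition robustly_computes (R : realType) (n : nat) (q : {mpoly R[n]})
    (h : pbool n) (delta : R) : Prop :=
  0 <= delta < 2%:R^-1 /\
  forall (x : cube n) (b : bool), h x = Some b ->
  forall Delta : 'I_n -> R, (forall i, - delta <= Delta i <= delta) ->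
    `|b%:R - q.@[fun i => cube_pt R x i + Delta i]| <= 3%:R^-1.

(* Main.v *)
Require Import Defs.
From mathcomp Require Import all_boot all_order all_algebra.
From mathcomp Require Import reals mpoly.
From mathcomp Require Import boolp complex zify ring lra.

(** Let p be the acceptance probability of an algorithm for h with T = Q(h)
    queries, a real function of degree 2T on the cube, and amplify it to
    B(p) with B(t) = 3 t^2 - 2 t^3.  The multilinear extension of B(p) at a point
    z of [0,1]^n is the mean of B(p(y)) when the y_i are independent bits with
    means z_i.  Taking q(x) to be this extension at delta + (1 - 2 delta) x
    keeps z in [0,1]^n when x is perturbed by at most delta, and then every bit
    of y differs from that of x with probability at most 2 delta.  For a fixed
    state this changes a single query by at most 8 delta in mean squared norm,
    hence the final state by at most 8 delta T^2 (hybrid argument), which is a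
    small constant for delta = c / T^2. *)

Set Implicit Arguments.
Unset Strict Implicit.
Unset Printing Implicit Defensive.

Import Order.TTheory GRing.Theory Num.Theory.
Local Open Scope ring_scope.

(** * Functions of bounded degree on the cube *)

(* The pair (c, S) encodes the monomial c * \prod_(i in S) x_i. *)
Definition cube_deg (K : comNzRingType) (n d : nat) (f : cube n -> K) : Prop :=
  exists2 s : seq (K * {set 'I_n}),
    all (fun t : K * {set 'I_n} => #|t.2| <= d)%N s &
    forall x, f x = \sum_(t <- s) t.1 * \prod_(i in t.2) (x i)%:R.

Lemma cube_deg_const (K : comNzRingType) (n d : nat) (c : K) :
  cube_deg d (fun _ : cube n => c).
Proof.
exists [:: (c, set0)]; first by rewrite /= cards0.
by move=> x; rewrite big_seq1 big_set0 mulr1.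
Qed.

Lemma cube_degD (K : comNzRingType) (n d : nat) (f g : cube n -> K) :
  cube_deg d f -> cube_deg d g -> cube_deg d (fun x => f x + g x).
Proof.
move=> [s sd fE] [t td gE]; exists (s ++ t); first by rewrite all_cat sd.
by move=> x; rewrite big_cat -fE -gE.
Qed.

Lemma cube_deg_sum (K : comNzRingType) (n d : nat) (I : finType) (P : pred I)
    (f : I -> cube n -> K) :
  (forall i, cube_deg d (f i)) ->
  cube_deg d (fun x => \sum_(i | P i) f i x).
Proof.
move=> fd; elim: (index_enum I) => [|i r [s sd sE]].
  by exists [::] => // x; rewrite !big_nil.
case: (boolP (P i)) => Pi; last first.
  by exists s => // x; rewrite big_cons (negPf Pi).
have [t td tE] := cube_degD (fd i) (ex_intro2 _ _ s sd sE).
by exists t => // x; rewrite big_cons Pi -tE.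
Qed.

(** Bits are idempotent, so repeated factors collapse. *)
Lemma prod_setU_cube (K : comNzRingType) (n : nat) (S S' : {set 'I_n})
    (x : cube n) :
  (\prod_(i in S) (x i)%:R) * (\prod_(i in S') (x i)%:R) =
  \prod_(i in S :|: S') (x i)%:R :> K.
Proof.
rewrite !(big_mkcond (fun i => i \in _)) -big_split; apply: eq_bigr => i _ /=.
by rewrite inE; case: (i \in S); case: (i \in S'); case: (x i);
  rewrite /= ?mulr1 ?mul1r ?mulr0.
Qed.

Lemma cube_degM (K : comNzRingType) (n d e : nat) (f g : cube n -> K) :
  cube_deg d f -> cube_deg e g ->
  cube_deg (d + e) (fun x => f x * g x).
Proof.
move=> [s sd fE] [t td gE].
exists [seq (u.1 * v.1, u.2 :|: v.2) | u <- s, v <- t].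
  apply/allP => _ /allpairsP [[u v] /= [us vt ->]] /=.
  rewrite (leq_trans (leq_card_setU _ _)) // leq_add //.
    exact: (allP sd).
  exact: (allP td).
move=> x; rewrite fE gE big_allpairs_dep mulr_suml; apply: eq_bigr => u _.
rewrite mulr_sumr; apply: eq_bigr => v _ /=.
by rewrite -prod_setU_cube mulrACA.
Qed.

(** Additivity of [phi] suffices because a monomial takes only the values 0 and 1 on the cube. This
    covers real and imaginary parts. *)
Lemma cube_deg_morph (K L : comNzRingType) (n d : nat) (phi : K -> L)
    (f : cube n -> K) :
  phi 0 = 0 -> {morph phi : a b / a + b} ->
  cube_deg d f -> cube_deg d (fun x => phi (f x)).
Proof.
move=> phi0 phiD [s sd fE]; exists [seq (phi t.1, t.2) | t <- s].
  by rewrite all_map; apply: sub_all sd.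
move=> x; rewrite fE big_map (big_morph phi phiD phi0); apply: eq_bigr => t _.
rewrite -!natr_prod /=.
have : (\prod_(i in t.2) x i <= 1)%N.
  by elim/big_ind: _ => // [[|[|?]] [|[|?]]|i _] //; case: (x i).
by case: (\prod_(i in t.2) x i)%N => [|[|?]] // _; rewrite ?mulr0 ?mulr1.
Qed.

(** Any function of one bit is affine in it; the index [None] always reads [false]. *)
Lemma cube_deg_bit (K : comNzRingType) (n : nat) (o : option 'I_n)
    (g : bool -> K) :
  cube_deg 1 (fun x => g (oapp x false o)).
Proof.
case: o => [i|]; last exact: (cube_deg_const n 1 (g false)).
exists [:: (g false, set0); (g true - g false, [set i])].
  by rewrite /= cards0 cards1.
move=> x; rewrite !big_cons big_nil big_set0 big_set1 /=.
by case: (x i); rewrite /= ?mulr1 ?mulr0 ?addr0 // addrCA subrr addr0.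
Qed.

(** * Product distributions and multilinear extensions *)

Definition product_weight (R : comNzRingType) (n : nat) (z : 'I_n -> R)
    (y : cube n) : R :=
  \prod_i (if y i then z i else 1 - z i).

(** Independence: the sum over the cube factors into one two-term sum per coordinate. *)
Lemma product_weight_monomial (R : comNzRingType) (n : nat) (z : 'I_n -> R)
    (S : {set 'I_n}) :
  \sum_y product_weight z y * \prod_(i in S) (y i)%:R = \prod_(i in S) z i.
Proof.
transitivity (\sum_(y : cube n) \prod_i
    ((if y i then z i else 1 - z i) * (if i \in S then (y i)%:R else 1))).
  apply: eq_bigr => y _; rewrite big_split /=; congr (_ * _).
  exact: big_mkcond.
rewrite -(bigA_distr_bigA (fun i (b : bool) =>
  (if b then z i else 1 - z i) * (if i \in S then b%:R else 1))).
rewrite [RHS]big_mkcond; apply: eq_bigr => i _; rewrite big_bool /=.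
by case: (i \in S); rewrite ?mulr1 ?mulr0 ?addr0 // addrC subrK.
Qed.

Lemma product_weight_sum (R : comNzRingType) (n : nat) (z : 'I_n -> R) :
  \sum_y product_weight z y = 1.
Proof.
have := product_weight_monomial z set0; rewrite big_set0 => <-.
by apply: eq_bigr => y _; rewrite big_set0 mulr1.
Qed.

Lemma product_weight_ge0 (R : realType) (n : nat) (z : 'I_n -> R) (y : cube n) :
  (forall i, 0 <= z i <= 1) -> 0 <= product_weight z y.
Proof.
move=> z01; apply: prodr_ge0 => i _; have /andP[z0 z1] := z01 i.
by case: (y i); rewrite ?subr_ge0.
Qed.

Lemma product_weight_flip (R : comNzRingType) (n : nat) (z : 'I_n -> R)
    (x : cube n) (i : 'I_n) :
  \sum_y product_weight z y * (y i != x i)%:R =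
  if x i then 1 - z i else z i.
Proof.
have Ez : \sum_y product_weight z y * (y i)%:R = z i.
  have := product_weight_monomial z [set i]; rewrite big_set1 => <-.
  by apply: eq_bigr => y _; rewrite big_set1.
case: (x i); last by rewrite -[RHS]Ez; apply: eq_bigr => y _; case: (y i).
rewrite -Ez -[X in _ = X - _](product_weight_sum z) -sumrB.
apply: eq_bigr => y _.
by case: (y i); rewrite /= ?mulr1 ?mulr0 ?subrr ?subr0.
Qed.

Lemma msupp_prod_affine (R : comNzRingType) (n : nat) (a b : R)
    (r : seq 'I_n) (m : 'X_{1..n}) :
  uniq r -> m \in msupp (\prod_(i <- r) (a%:MP_[n] + b *: 'X_i)) ->
  forall j, (m j <= (j \in r))%N.
Proof.
elim: r m => [|i r IHr] m.
  by move=> _; rewrite big_nil msupp1 inE => /eqP -> j; rewrite mnm0E.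
move=> /= /andP[ir rU]; rewrite big_cons => /msuppM_le.
move=> /allpairsP [[m1 m2] /= [m1s m2s ->]] j; rewrite mnmDE inE.
have {}m2s := IHr _ rU m2s j.
have m1j : (m1 j <= (i == j))%N.
  have /msuppD_le := m1s; rewrite mem_cat => /orP[].
    rewrite msuppC; case: ifP => //= _; rewrite inE => /eqP ->.
    by rewrite mnm0E.
  by move=> /msuppZ_le; rewrite msuppX inE => /eqP ->; rewrite mnm1E.
rewrite (leq_trans (leq_add m1j m2s)) // eq_sym.
by have [->|_] := eqVneq j i; rewrite ?(negPf ir).
Qed.

(** Replacing every [x i] in the monomials of [f] by [a + b * z i] gives [q]; by
    [product_weight_monomial] its value is a mean of [f], as an identity valid at every real
    point. *)
Lemma cube_deg_affine_poly (R : realType) (n d : nat) (a b : R)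
    (f : cube n -> R) :
  cube_deg d f ->
  exists q : {mpoly R[n]},
    [/\ multilinear_mpoly q, (mdegree q <= d)%N &
     forall z, q.@[z] =
       \sum_y product_weight (fun i => a + b * z i) y * f y].
Proof.
move=> [s sd fE].
pose q (S : {set 'I_n}) := \prod_(i <- enum S) (a%:MP_[n] + b *: 'X_i).
have qS (S : {set 'I_n}) m :
    m \in msupp (q S) -> forall j, (m j <= (j \in S))%N.
  move=> mq j; rewrite -mem_enum.
  by apply: msupp_prod_affine mq j; rewrite enum_uniq.
pose p := \sum_(t <- s) t.1 *: q t.2.
have pP m : m \in msupp p ->
    exists2 S : {set 'I_n}, (#|S| <= d)%N & forall j, (m j <= (j \in S))%N.
  rewrite /p; elim: s sd {fE p} => [_|t s IHs /= /andP[td sd]].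
    by rewrite big_nil msupp0.
  rewrite big_cons => /msuppD_le; rewrite mem_cat => /orP[|/(IHs sd)] //.
  by move=> /msuppZ_le /qS mt; exists t.2.
exists p; split.
- by move=> m /pP [S _ mS] i; apply: leq_trans (mS i) _; case: (i \in S).
- rewrite /mdegree; have : (msize p <= d.+1)%N; last by case: (msize p).
  rewrite msizeE; apply/bigmax_leqP_seq => m /pP [S Sd mS] _.
  rewrite ltnS mdegE; apply: leq_trans Sd.
  rewrite -sum1_card [leqRHS]big_mkcond; apply: leq_sum => i _.
  by apply: leq_trans (mS i) _; case: (i \in S).
- move=> z; rewrite /p raddf_sum /=.
  under [RHS]eq_bigr => y _ do rewrite fE mulr_sumr.
  rewrite exchange_big /=; apply: eq_bigr => t _.
  rewrite mevalZ /q rmorph_prod /= big_enum /=.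
  rewrite (eq_bigr (fun i => a + b * z i)) => [|i _]; last first.
    by rewrite mevalD mevalC mevalZ mevalXU.
  rewrite -(product_weight_monomial (fun i => a + b * z i)).
  by rewrite mulr_sumr; apply: eq_bigr => y _; rewrite mulrCA.
Qed.

(** * Squared norms and amplitudes of query algorithms *)

Definition normsq (R : realType) (z : R[i]) : R :=
  complex.Re z ^+ 2 + complex.Im z ^+ 2.

Definition sumsq (R : realType) (m : nat) (v : 'cV[R[i]]_m) : R :=
  \sum_i normsq (v i 0).

Lemma normsq_ge0 (R : realType) (z : R[i]) : 0 <= normsq z.
Proof. by rewrite addr_ge0 ?sqr_ge0. Qed.

Lemma sumsqE (R : realType) (m : nat) (v : 'cV[R[i]]_m) :
  (sumsq v)%:C%C = ((v ^t*)%sesqui *m v) 0 0.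
Proof.
rewrite mxE (rmorph_sum (real_complex R)) /=; apply: eq_bigr => i _.
by rewrite add_Re2_Im2 normCK !mxE mulrC.
Qed.

Lemma sumsq_unitary (R : realType) (m : nat) (U : 'M[R[i]]_m)
    (v : 'cV[R[i]]_m) :
  U \is unitarymx -> sumsq (U *m v) = sumsq v.
Proof.
move=> /unitarymxP /mulmx1C UU; apply: (fmorph_inj (real_complex R)).
rewrite /= !sumsqE trmx_mul map_mxM -mulmxA (mulmxA _ U) UU mul1mx //.
Qed.

Lemma queryK (n : nat) (W : finType) (x : cube n) : involutive (@query n W x).
Proof. by move=> [[i b] w] /=; rewrite -addbA addbb addbF. Qed.

Lemma query_unitary (R : realType) (n : nat) (W : finType) (x : cube n) :
  basis_mx R[i] (@query n W x) \is unitarymx.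
Proof. exact/basis_mx_unitary/inv_inj/queryK. Qed.

Lemma basis_mx_query (K : nzRingType) (n : nat) (W : finType) (x : cube n)
    (v : 'cV[K]_#|qbasis n W|) (s : qbasis n W) :
  (basis_mx K (@query n W x) *m v) (enum_rank s) 0 =
  v (enum_rank (query x s)) 0.
Proof.
rewrite mxE (bigD1 (enum_rank (query x s))) //= !mxE !enum_rankK queryK eqxx.
rewrite mul1r big1 ?addr0 // => j js; rewrite mxE enum_rankK.
rewrite (_ : _ == _ = false) ?mul0r //; apply: contraNF js => /eqP ->.
by rewrite queryK enum_valK.
Qed.

Lemma qstate_sumsq (R : realType) (n : nat) (A : qalgorithm R n) (x : cube n)
    (T : nat) :
  sumsq (qstate A x T) = 1.
Proof.
elim: T => [|T IHT] /=; rewrite sumsq_unitary ?qunitaryP //.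
  rewrite /sumsq (bigD1 (enum_rank (qstart A))) //= big1 => [|i /negPf ik].
    by rewrite mxE !eqxx /normsq /= expr1n expr0n !addr0.
  by rewrite mxE ik /normsq /= !expr0n addr0.
by rewrite sumsq_unitary ?query_unitary.
Qed.

(** Polynomial method: the unitaries do not depend on the input, and each query raises the degree of
    the amplitudes by at most one. *)
Lemma qstate_cube_deg (R : realType) (n : nat) (A : qalgorithm R n) (T : nat)
    (i : 'I_#|qbasis n (qwork A)|) :
  cube_deg T (fun x => qstate A x T i 0).
Proof.
elim: T i => [|T IHT] i; first exact: (cube_deg_const n 0 _).
rewrite /=; suff H j : cube_deg T.+1
    (fun x => (basis_mx _ (query x) *m qstate A x T) j 0).
  have := cube_deg_sum xpredT (fun j =>
    cube_degM (cube_deg_const n 0 (qunitary A T.+1 i j)) (H j)).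
  by move=> [s sd sE]; exists s => // x; rewrite mxE -sE.
(* Column [k] of the query matrix depends on [x] only through the bit that [k] queries. *)
have H k := cube_degM (cube_deg_bit (enum_val k).1.1 (fun c =>
  let: (o, b, w) := enum_val k in
  (enum_val j == (o, b (+) c, w))%:R)) (IHT k).
have [s sd sE] := cube_deg_sum xpredT H.
exists s => // x; rewrite mxE -sE; apply: eq_bigr => k _; rewrite mxE.
by case: (enum_val k) => [[o b] w].
Qed.

(** * The acceptance probability *)

Definition accept (R : realType) (n : nat) (A : qalgorithm R n) (T : nat)
    (x : cube n) : R :=
  \sum_(s | qoutcome s) normsq (qstate A x T (enum_rank s) 0).

Lemma sumsq_enum_rank (R : realType) (S : finType) (v : 'cV[R[i]]_#|S|) :
  sumsq v = \sum_s normsq (v (enum_rank s) 0).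
Proof.
rewrite /sumsq (reindex (@enum_rank S)) //; exact/onW_bij/enum_rank_bij.
Qed.

Lemma accept_cube_deg (R : realType) (n : nat) (A : qalgorithm R n) (T : nat) :
  cube_deg (T + T) (accept A T).
Proof.
apply: cube_deg_sum => s; have ad := qstate_cube_deg T (enum_rank s).
have Red := cube_deg_morph (phi := @complex.Re R) erefl _ ad.
have Imd := cube_deg_morph (phi := @complex.Im R) erefl _ ad.
apply: cube_degD; apply: cube_degM.
- by apply: Red => -[? ?] [? ?].
- by apply: Red => -[? ?] [? ?].
- by apply: Imd => -[? ?] [? ?].
- by apply: Imd => -[? ?] [? ?].
Qed.

Lemma accept_ge0 (R : realType) (n : nat) (A : qalgorithm R n) (T : nat)
    (x : cube n) :
  0 <= accept A T x.
Proof. by apply: sumr_ge0 => s _; apply: normsq_ge0. Qed.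

Lemma accept_compl (R : realType) (n : nat) (A : qalgorithm R n) (T : nat)
    (x : cube n) :
  accept A T x +
  \sum_(s | ~~ qoutcome s) normsq (qstate A x T (enum_rank s) 0) = 1.
Proof.
by rewrite -(qstate_sumsq A x T) sumsq_enum_rank [RHS](bigID (@qoutcome R n A)).
Qed.

Lemma accept_le1 (R : realType) (n : nat) (A : qalgorithm R n) (T : nat)
    (x : cube n) :
  accept A T x <= 1.
Proof.
rewrite -(accept_compl A T x) lerDl.
by apply: sumr_ge0 => s _; apply: normsq_ge0.
Qed.

Lemma accept_error (R : realType) (n : nat) (A : qalgorithm R n) (T : nat)
    (x : cube n) (b : bool) :
  2%:R / 3%:R <= qprob A T x b -> `|b%:R - accept A T x| <= 3%:R^-1.
Proof.
have -> : qprob A T x b = (\sum_(s | qoutcome s == b)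
    normsq (qstate A x T (enum_rank s) 0))%:C%C.
  rewrite (rmorph_sum (real_complex R)) /qprob; apply: eq_bigr => s _ /=.
  by rewrite add_Re2_Im2.
have -> : 2%:R / 3%:R = (2%:R / 3%:R : R)%:C%C :> R[i].
  by rewrite (fmorph_div (real_complex R)) !rmorph_nat.
rewrite lecR.
have le1 := accept_le1 A T x; have ge0 := accept_ge0 A T x.
have sum1 := accept_compl A T x.
case: b => /=.
  rewrite [X in _ <= X -> _](eq_bigl (@qoutcome R n A)) => [|s]; last first.
    by case: (qoutcome s).
  by rewrite -/(accept A T x) => ?; rewrite ger0_norm; lra.
rewrite [X in _ <= X -> _](eq_bigl (fun s => ~~ @qoutcome R n A s)) => [|s].
  by move=> ?; rewrite ler0_norm; lra.
by case: (qoutcome s).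
Qed.

(** * The hybrid argument and its inequalities *)

Lemma normsq_sub_le (R : realType) (a b : R[i]) :
  normsq (a - b) <= 2%:R * (normsq a + normsq b).
Proof.
case: a b => [a a'] [b b']; rewrite /normsq /=.
have := sqr_ge0 (a + b); have := sqr_ge0 (a' + b'); nra.
Qed.

(** Young's inequality with denominators cleared; the slack is the squared modulus of
    [a - t * b]. *)
Lemma normsq_add_le (R : realType) (t : R) (a b : R[i]) :
  t * normsq (a + b) <= (t + 1) * normsq a + t * (t + 1) * normsq b.
Proof.
case: a b => [a a'] [b b']; rewrite /normsq /= -subr_ge0.
rewrite (_ : _ - _ = (a - t * b) ^+ 2 + (a' - t * b') ^+ 2); last by ring.
by rewrite addr_ge0 ?sqr_ge0.
Qed.

Lemma normsq_diff_le (R : realType) (l : R) (a b : R[i]) :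
  0 < l ->
  `|normsq a - normsq b| <=
    l / 2%:R * normsq (a - b) + l^-1 * (normsq a + normsq b).
Proof.
move=> l0.
have l0' : 0 < l^-1 by rewrite invr_gt0.
have ll : l * l^-1 = 1 by rewrite divff ?gt_eqF.
set k := l^-1 in l0' ll *.
have lE (u v : R) : 0 <= l / 2%:R * (u - v) ^+ 2 + k / 2%:R * (u + v) ^+ 2
    - (u ^+ 2 - v ^+ 2).
  (* AM-GM: [u^2 - v^2 <= l/2 (u - v)^2 + 1/(2l) (u + v)^2] *)
  rewrite (_ : _ - _ = l / 2%:R * ((u - v) - k * (u + v)) ^+ 2 +
    (k / 2%:R * (u + v) ^+ 2 - (l * k) * k / 2%:R * (u + v)^+2) +
    (l * k - 1) * (u ^+ 2 - v ^+ 2)); last by field.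
  rewrite ll mul1r !subrr mul0r !addr0 mulr_ge0 ?sqr_ge0 // divr_ge0 // ltW //.
case: a b => [a a'] [b b']; rewrite /normsq /=.
have := lE a b; have := lE b a; have := lE a' b'; have := lE b' a'.
(* Used to replace [(u + v) ^+ 2] by its upper bound [2 (u ^+ 2 + v ^+ 2)]. *)
have h u v :
    k * (2%:R * (u ^+ 2 + v ^+ 2) - (u + v) ^+ 2) = k * (u - v) ^+ 2 by ring.
have k0 u : 0 <= k * u ^+ 2 by rewrite mulr_ge0 ?sqr_ge0 ?ltW.
have := k0 (a - b); have := k0 (a' - b').
rewrite ler_norml -!h; nra.
Qed.

(** The hybrid: the state is that of the run on [x], and only the next query is answered by [y]. *)
Definition query_gap (R : realType) (n : nat) (A : qalgorithm R n)
    (x y : cube n) (T : nat) : R :=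
  sumsq (basis_mx _ (query y) *m qstate A x T -
             basis_mx _ (query x) *m qstate A x T).

Definition state_gap (R : realType) (n : nat) (A : qalgorithm R n)
    (x y : cube n) (T : nat) : R :=
  sumsq (qstate A y T - qstate A x T).

Definition differ (n : nat) (x y : cube n) (o : option 'I_n) : bool :=
  oapp y false o != oapp x false o.

(** Only basis states whose queried bit differs contribute. There [normsq_sub_le] costs a factor 2,
    and the two terms have equal sums since a query permutes basis states and keeps their index. *)
Lemma query_gap_le (R : realType) (n : nat) (A : qalgorithm R n)
    (x y : cube n) (T : nat) :
  query_gap A x y T <=
  4%:R * \sum_s (differ x y s.1.1)%:R * normsq (qstate A x T (enum_rank s) 0).
Proof.
set v := qstate A x T.
pose d (s : qbasis n (qwork A)) : R := (differ x y s.1.1)%:R.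
pose g z s := d s * normsq (v (enum_rank (query z s)) 0).
have gE z : \sum_s g z s = \sum_s d s * normsq (v (enum_rank s) 0).
  rewrite [RHS](reindex_inj (inv_inj (@queryK n _ z))).
  by apply: eq_bigr => -[[o b] w] _.
have -> : 4%:R * \sum_s d s * normsq (v (enum_rank s) 0) =
    \sum_s 2%:R * (g y s + g x s).
  by rewrite -mulr_sumr big_split /= !gE; ring.
rewrite /query_gap sumsq_enum_rank; apply: ler_sum => s _.
rewrite mxE [X in _ + X]mxE !basis_mx_query -/v /g /d /differ.
case: s => [[o b] w] /=; case: eqVneq => [->|_] /=.
  by rewrite subrr !mul0r /normsq /= expr0n !addr0 mulr0.
by rewrite !mul1r normsq_sub_le.
Qed.

(** The new difference is [Oy] applied to the old one, which keeps its norm, plus the effect of one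
    changed query on the run on [x]. *)
Lemma state_gapS (R : realType) (n : nat) (A : qalgorithm R n)
    (x y : cube n) (T : nat) (t : R) :
  t * state_gap A x y T.+1 <=
  (t + 1) * state_gap A x y T + t * (t + 1) * query_gap A x y T.
Proof.
rewrite /state_gap /= -mulmxBr sumsq_unitary ?qunitaryP //.
set Oy := basis_mx _ (query y); set Ox := basis_mx _ (query x).
have -> : Oy *m qstate A y T - Ox *m qstate A x T =
    Oy *m (qstate A y T - qstate A x T) +
    (Oy *m qstate A x T - Ox *m qstate A x T).
  by rewrite mulmxBr addrA subrK.
rewrite -(sumsq_unitary (U := Oy) (qstate A y T - _)) ?query_unitary //.
rewrite /query_gap -/Oy -/Ox /sumsq !mulr_sumr -big_split /=.
by apply: ler_sum => i _; rewrite [X in normsq X]mxE normsq_add_le.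
Qed.

(* For t > 0, state_gapS reads
   gap (t + 1) <= (1 + 1/t) gap t + (t + 1) query_gap t,
   and (1 + 1/t) t^2 + (t + 1) = (t + 1)^2. *)
Lemma state_gap_sum (R : realType) (n : nat) (A : qalgorithm R n)
    (x : cube n) (w : cube n -> R) (K : R) (T : nat) :
  (forall y, 0 <= w y) ->
  (forall t, \sum_y w y * query_gap A x y t <= K) ->
  \sum_y w y * state_gap A x y T <= T%:R ^+ 2 * K.
Proof.
move=> w0 wK.
have gap0 y : state_gap A x y 0 = 0.
  rewrite /state_gap /= subrr /sumsq big1 // => i _.
  by rewrite mxE /normsq /= expr0n addr0.
elim: T => [|T IHT].
  by rewrite big1 => [|y _]; rewrite ?gap0 ?mulr0 // expr0n mul0r.
have step (t : R) : 0 <= t ->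
    t * \sum_y w y * state_gap A x y T.+1 <=
    (t + 1) * \sum_y w y * state_gap A x y T + t * (t + 1) * K.
  move=> t0.
  apply: (@le_trans _ _ ((t + 1) * \sum_y w y * state_gap A x y T
      + t * (t + 1) * \sum_y w y * query_gap A x y T)); last first.
    by rewrite lerD2l ler_wpM2l // mulr_ge0 // addr_ge0.
  rewrite !mulr_sumr -big_split /=; apply: ler_sum => y _.
  have := ler_wpM2l (w0 y) (state_gapS A x y T t); nra.
(* The first query is treated directly, since [step] is void at [t = 0]. *)
case: T IHT step => [|T] IHT step.
  rewrite expr1n mul1r; apply: le_trans (wK 0); apply: ler_sum => y _.
  by rewrite /state_gap /= -mulmxBr sumsq_unitary ?qunitaryP.
have T0 : 0 < T.+1%:R :> R by rewrite ltr0n.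
have := step T.+1%:R (ltW T0); rewrite -[T.+2]addn1 natrD.
move: (T.+1%:R) T0 IHT => t t0 IHT h.
rewrite -(ler_pM2l t0) (le_trans h) //.
nra.
Qed.

(** Sum [normsq_diff_le] over the outcomes; both states are unit vectors, whence the 2. The bound is
    linear in [state_gap], so it can be averaged over [y]. *)
Lemma accept_diff_le (R : realType) (n : nat) (A : qalgorithm R n) (T : nat)
    (x y : cube n) (l : R) :
  0 < l ->
  `|accept A T y - accept A T x| <=
    l / 2%:R * state_gap A x y T + l^-1 * 2%:R.
Proof.
move=> l0; have l0' : 0 <= l^-1 by rewrite invr_ge0 ltW.
have l2 : 0 <= l / 2%:R by rewrite divr_ge0 // ltW.
rewrite [X in l^-1 * X](_ : _ = sumsq (qstate A y T) + sumsq (qstate A x T));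
  last by rewrite !qstate_sumsq.
rewrite /accept -sumrB (le_trans (ler_norm_sum _ _ _)) //.
rewrite /state_gap !sumsq_enum_rank -big_split /= !mulr_sumr -big_split /=.
rewrite [leRHS](bigID (@qoutcome R n A)) /=; apply: ler_wpDr.
  apply: sumr_ge0 => s _.
  apply: addr_ge0; apply: mulr_ge0; rewrite ?normsq_ge0 //.
  by rewrite addr_ge0 ?normsq_ge0.
apply: ler_sum => s _; apply: le_trans (normsq_diff_le _ _ l0) _.
by rewrite ![in leRHS]mxE.
Qed.

(** * Amplification *)

(** The probability that a majority of three independent runs accepts. It makes the error smaller
    than 1/3, leaving room for the noise; the shape of the formula matches [cube_degM] and
    [cube_degD]. *)
Definition amplify (R : comNzRingType) (p : R) : R :=
  p * p * (3%:R + -2%:R * p).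

Lemma amplify01 (R : realType) (p : R) : 0 <= p <= 1 -> 0 <= amplify p <= 1.
Proof.
move=> /andP[p0 p1]; rewrite /amplify; apply/andP; split.
  by rewrite mulr_ge0 ?mulr_ge0 //; lra.
have : 0 <= (1 - p) ^+ 2 * (1 + 2%:R * p) by rewrite mulr_ge0 ?sqr_ge0 //; lra.
nra.
Qed.

(** The derivative [6 p (1 - p)] is at most 3/2 on [[0, 1]]. *)
Lemma amplify_lipschitz (R : realType) (u v : R) :
  0 <= u <= 1 -> 0 <= v <= 1 ->
  `|amplify u - amplify v| <= 3%:R / 2%:R * `|u - v|.
Proof.
move=> /andP[u0 u1] /andP[v0 v1].
rewrite (_ : _ - _ =
  (3%:R * (u + v) - 2%:R * (u ^+ 2 + u * v + v ^+ 2)) * (u - v)); last first.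
  by rewrite /amplify; ring.
rewrite normrM ler_wpM2r // ler_norml; apply/andP; split.
  have : 0 <= u * (1 - u) by rewrite mulr_ge0 ?subr_ge0.
  have : 0 <= v * (1 - v) by rewrite mulr_ge0 ?subr_ge0.
  have : 0 <= u * (1 - v) by rewrite mulr_ge0 ?subr_ge0.
  have : 0 <= v * (1 - u) by rewrite mulr_ge0 ?subr_ge0.
  nra.
have := sqr_ge0 (u - v); have := sqr_ge0 (u + v - 1); nra.
Qed.

Lemma amplify_error (R : realType) (b : bool) (p : R) :
  0 <= p <= 1 -> `|b%:R - p| <= 3%:R^-1 ->
  `|b%:R - amplify p| <= 7%:R / 27%:R.
Proof.
move=> /andP[p0 p1]; rewrite ler_norml /amplify => /andP[h1 h2].
have a01 := @amplify01 R p; rewrite /amplify in a01.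
have /andP[a0 a1] : 0 <= p * p * (3%:R + -2%:R * p) <= 1 by rewrite a01 ?p0.
have pp : 0 <= p * (1 - p) by rewrite mulr_ge0 ?subr_ge0.
rewrite ler_norml; case: b h1 h2 => /= h1 h2; apply/andP; split; try lra.
  (* This product is [amplify p - 20/27], and the one for [b = false] is [7/27 - amplify p]. *)
  have : 0 <= (p - 2%:R / 3%:R) *
      (2%:R * (p * (1 - p)) + (10%:R / 9%:R - p / 3%:R)).
    by rewrite mulr_ge0 //; lra.
  nra.
have : 0 <= (3%:R^-1 - p) * (2%:R * (p * (1 - p)) + (7%:R / 9%:R + p / 3%:R)).
  by rewrite mulr_ge0 //; lra.
nra.
Qed.

(** * Random inputs and the final estimate *)

(** The state of the run on [x] does not depend on [y], so averaging bounds each indicator [differ]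
    by [e], and the squared amplitudes sum to 1. *)
Lemma query_gap_noise (R : realType) (n : nat) (A : qalgorithm R n)
    (x : cube n) (z : 'I_n -> R) (e : R) (t : nat) :
  0 <= e -> (forall i, 0 <= z i <= 1) ->
  (forall i, (if x i then 1 - z i else z i) <= e) ->
  \sum_y product_weight z y * query_gap A x y t <= 4%:R * e.
Proof.
move=> e0 z01 ze; set v := qstate A x t.
apply: (@le_trans _ _ (\sum_y \sum_s 4%:R * normsq (v (enum_rank s) 0) *
    (product_weight z y * (differ x y s.1.1)%:R))).
  apply: ler_sum => y _.
  apply: le_trans (ler_wpM2l (product_weight_ge0 y z01)
    (query_gap_le _ _ _ _)) _.
  by rewrite !mulr_sumr; apply: ler_sum => s _; rewrite -/v; lra.
rewrite exchange_big /= -[leRHS]mulr1.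
rewrite -[X in _ <= _ * X](qstate_sumsq A x t).
rewrite sumsq_enum_rank mulr_sumr; apply: ler_sum => s _.
rewrite -mulr_sumr -/v [leRHS]mulrAC ler_wpM2l ?mulr_ge0 ?normsq_ge0 //.
case: s.1.1 => [i|]; last by rewrite big1 // => y _; rewrite mulr0.
by rewrite product_weight_flip.
Qed.

Theorem theorem17 (R : realType) :
  exists c C : R, 0 < c /\ 0 < C /\
    forall (n : nat) (h : pbool n),
    exists q : {mpoly R[n]},
      bounded_mpoly q /\ multilinear_mpoly q /\
      (mdegree q)%:R <= C * (Qquery R h)%:R /\
      robustly_computes q h (c / (maxn 1 (Qquery R h))%:R ^+ 2).
Proof.
(* The error is at most 7/27 + 3/l + 6 c l, where l is the parameter of
   accept_diff_le; l = 81 and this c make the last two terms equal to 1/27. *)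
pose c : R := (162%:R * 81%:R)^-1.
have c0 : 0 < c by rewrite invr_gt0 mulr_gt0 ?ltr0n.
have cE : 162%:R * 81%:R * c = 1 by rewrite divff // mulf_neq0 ?pnatr_eq0.
(* The degree is [6 T]: [amplify] is cubic and [accept] has degree [2 T]. *)
exists c, 6%:R; split=> //; split=> [|n h]; first by rewrite ltr0n.
rewrite /Qquery; case: ex_minnP => T /asboolP [A Ah] _.
set delta := _ / _.
have M1 : 1 <= (maxn 1 T)%:R ^+ 2 :> R by rewrite -natrX ler1n expn_gt0 leq_max.
have [d0 d1 dT] : [/\ 0 <= delta, delta <= c &
    T%:R ^+ 2 * delta <= c].
  have M0 : 0 < (maxn 1 T)%:R ^+ 2 :> R by apply: lt_le_trans M1.
  split; rewrite /delta; first by rewrite divr_ge0 // ltW.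
    by rewrite ler_pdivrMr // ler_peMr // ltW.
  rewrite mulrA ler_pdivrMr // mulrC ler_wpM2l ?(ltW c0) // -!natrX ler_nat.
  by rewrite leq_sqr leq_maxr.
pose p := accept A T.
have p01 y : 0 <= p y <= 1 by rewrite accept_ge0 accept_le1.
have pd := accept_cube_deg A T.
have [q [qm qd qE]] := cube_deg_affine_poly delta (1 - 2%:R * delta)
  (cube_degM (cube_degM pd pd)
    (cube_degD (cube_deg_const n _ 3%:R)
      (cube_degM (cube_deg_const n 0 (- 2%:R)) pd))).
have {}qE z : q.@[z] = \sum_y
    product_weight (fun i => delta + (1 - 2%:R * delta) * z i) y *
    amplify (p y) by [].
have d2 : delta < 2%:R^-1 by apply: le_lt_trans d1 _; lra.
exists q; split; [|split; [exact: qm|split]].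
- move=> x; rewrite qE.
  (* At a cube point each mean is [delta] or [1 - delta], so [q] is an average of values of
     [amplify]. *)
  set z := (fun i : 'I_n => _).
  have w0 y : 0 <= product_weight z y.
    apply: product_weight_ge0 => i; rewrite /z /cube_pt.
    by case: (x i) => /=; apply/andP; split; lra.
  rewrite -[X in _ <= _ <= X](product_weight_sum z).
  apply/andP; split; [apply: sumr_ge0|apply: ler_sum] => y _;
    have /andP[? ?] := amplify01 (p01 y); first exact: mulr_ge0.
  by rewrite -[leRHS]mulr1 ler_wpM2l.
- rewrite -natrM ler_nat; apply: leq_trans qd _; lia.
split=> [|x b hx D Dd]; first by rewrite d0.
rewrite qE; set z := (fun i : 'I_n => _).
(* For [x i = false] the mean lies between [2 delta ^+ 2] and [2 delta - 2 delta ^+ 2]; the other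
   case is symmetric. *)
have zx i : 0 <= z i <= 1 /\ (if x i then 1 - z i else z i) <= 2%:R * delta.
  rewrite /z /cube_pt; have /andP[] := Dd i.
  move=> Dl Du; have d3 : 0 <= 1 - 2%:R * delta by lra.
  have := mulr_ge0 d3 (_ : 0 <= D i + delta).
  have := mulr_ge0 d3 (_ : 0 <= delta - D i).
  have := mulr_ge0 d0 d0.
  by case: (x i) => /= ? /(_ ltac:(lra)) ? /(_ ltac:(lra)) ?;
    (split; first (apply/andP; split)); nra.
have z01 i : 0 <= z i <= 1 by case: (zx i).
have ze i : (if x i then 1 - z i else z i) <= 2%:R * delta by case: (zx i).
have w0 y := product_weight_ge0 y z01.
have err := accept_error (Ah x b hx).
have gap : \sum_y product_weight z y * state_gap A x y T <=
    T%:R ^+ 2 * (4%:R * (2%:R * delta)).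
  apply: state_gap_sum => // t; apply: query_gap_noise => //.
  by rewrite mulr_ge0.
(* With [l = 81]: 8/27 is 7/27 + 3/2 · 2/81, and 243/4 is 3/2 · 81/2. *)
have pt y : `|b%:R - amplify (p y)| <=
    8%:R / 27%:R + 243%:R / 4%:R * state_gap A x y T.
  have := accept_diff_le A T x y (ltr0Sn R 80).
  have := amplify_lipschitz (p01 x) (p01 y).
  have := amplify_error (p01 x) err.
  have := ler_distD (amplify (p x)) b%:R (amplify (p y)).
  rewrite -/(p x) -/(p y) (distrC (p y)); lra.
rewrite -[b%:R]mul1r -[X in X * _](product_weight_sum z) mulr_suml -sumrB.
apply: le_trans (ler_norm_sum _ _ _) _.
apply: (@le_trans _ _ (\sum_y product_weight z y *
   (8%:R / 27%:R + 243%:R / 4%:R * state_gap A x y T))).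
  by apply: ler_sum => y _; rewrite -mulrBr normrM ger0_norm // ler_wpM2l.
under eq_bigr => y _ do rewrite mulrDr [in X in _ + X]mulrCA.
rewrite big_split /= -mulr_suml product_weight_sum mul1r -mulr_sumr.
(* The noise term is at most 243/4 · 8 [c] = 486 [c] = 1/27, for a total of 1/3. *)
move: gap dT cE; set g := \sum_y _; set u := T%:R ^+ 2; lra.
Qed.
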